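(* Let $1\le p\le n$, $m\ge1$, $A\in\mathcal M_{m\times n}(\mathbb R)$ and $B\in\mathcal M_{m\times p}(\mathbb R)$. A matrix $U\in St^n_p$ is a critical point of the Procrustes cost function $\widetilde G:St^n_p\to\mathbb R$, $\widetilde G(U)=\frac12\|AU-B\|^2$, if and only if: (i) the matrix $B^TAU$ is symmetric; (ii) $(\mathbb I_n-UU^T)(A^TAU-A^TB)=\mathbf 0$.
   Context: $St_p^n=\{U\in\mathcal M_{n\times p}(\mathbb R)\mid U^TU=\mathbb I_p\}$ is the orthogonal Stiefel manifold and $\|\cdot\|$ is the Frobenius norm. *)

(* Defs.v *)
From HB Require Import structures.
From mathcomp Require Import all_boot all_order all_algebra.
From mathcomp Require Import all_classical all_reals all_analysis.

Set Implicit Arguments.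
Unset Strict Implicit.
Unset Printing Implicit Defensive.

Import Order.TTheory GRing.Theory Num.Theory.
Import numFieldNormedType.Exports.

Local Open Scope classical_set_scope.
Local Open Scope ring_scope.

Definition stiefel (R : realType) (n p : nat) : set 'M[R]_(n, p) :=
  [set U | U^T *m U = 1%:M].

(* The library's norm on matrices is the max norm, hence this definition. *)
Definition frobenius_norm (R : realType) (m n : nat) (X : 'M[R]_(m, n)) : R :=
  Num.sqrt (\sum_i \sum_j X i j ^+ 2).

(* c is a C^infinity curve ]-e, e[ -> S with c 0 = U; the values of c outside
   ]-e, e[ are irrelevant, as each iterated derivative at t depends only on the
   values of c near t. *)
Definition smooth_curve_through (R : realType) (n p : nat)
    (S : set 'M[R]_(n, p)) (U : 'M[R]_(n, p)) (e : R) (c : R -> 'M[R]_(n, p)) :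
    Prop :=
  [/\ forall t, `|t| < e -> S (c t),
      forall i j k t, `|t| < e -> derivable (derive1n k (fun s => c s i j)) t 1
    & c 0 = U].

(* U is a critical point of the restriction f|_S, for S an embedded submanifold
   of the space of matrices: the differential d(f|_S)_U vanishes on T_U S. The
   tangent vectors at U are the velocities c'(0) of the smooth curves c in S
   through U, and d(f|_S)_U (c'(0)) = (f o c)'(0). Only the values of f on S
   matter. *)
Definition critical_point_on (R : realType) (n p : nat)
    (S : set 'M[R]_(n, p)) (f : 'M[R]_(n, p) -> R) (U : 'M[R]_(n, p)) : Prop :=
  S U /\
  forall (e : R) (c : R -> 'M[R]_(n, p)),
    0 < e -> smooth_curve_through S U e c ->
    is_derive (0 : R) (1 : R) (fun t => f (c t)) 0.

Definition procrustes_cost (R : realType) (m n p : nat)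
    (A : 'M[R]_(m, n)) (B : 'M[R]_(m, p)) (U : 'M[R]_(n, p)) : R :=
  2^-1 * frobenius_norm (A *m U - B) ^+ 2.

(* Main.v *)
Require Import Defs.
From HB Require Import structures.
From mathcomp Require Import all_boot all_order all_algebra.
From mathcomp Require Import all_classical all_reals all_analysis.
From mathcomp Require Import ring.

Set Implicit Arguments.
Unset Strict Implicit.
Unset Printing Implicit Defensive.

Import Order.TTheory GRing.Theory Num.Theory.
Import numFieldNormedType.Exports.

Local Open Scope ring_scope.

(** Let [G := A^T *m (A *m U - B)] be the Euclidean gradient of the cost at [U];
    along a curve [c] through [U] the cost has derivative [\tr (G^T *m c'(0))].
    Curves in the Stiefel manifold have [U^T *m c'(0)] skew-symmetric, so (i) and
    (ii), which say that [U^T *m G] is symmetric and [G = U *m U^T *m G], make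
    this trace vanish. Conversely, rotating [U] in each coordinate plane of R^n
    gives curves with velocity [(E_ab - E_ba) *m U]; they force [U *m G^T] to be
    symmetric, and (i) and (ii) follow by multiplying by [U]. *)

(** * Calculus of matrix curves, entry by entry as in [smooth_curve_through] *)

Definition mx_is_derive (R : realType) (m n : nat) (x : R)
    (X : R -> 'M[R]_(m, n)) (D : 'M[R]_(m, n)) : Prop :=
  forall i j, is_derive x 1 (fun t => X t i j) (D i j).

Lemma mx_is_derive_cst (R : realType) (m n : nat) (x : R) (M : 'M[R]_(m, n)) :
  mx_is_derive x (fun=> M) 0.
Proof. by move=> i j; rewrite mxE; exact: is_derive_cst. Qed.

Lemma mx_is_derive_tr (R : realType) (m n : nat) (x : R)
    (X : R -> 'M[R]_(m, n)) (D : 'M[R]_(m, n)) :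
  mx_is_derive x X D -> mx_is_derive x (fun t => (X t)^T) D^T.
Proof.
move=> XD i j; rewrite mxE.
by under eq_fun do rewrite mxE; exact: XD.
Qed.

Lemma mx_is_deriveB (R : realType) (m n : nat) (x : R)
    (X Y : R -> 'M[R]_(m, n)) (DX DY : 'M[R]_(m, n)) :
  mx_is_derive x X DX -> mx_is_derive x Y DY ->
  mx_is_derive x (fun t => X t - Y t) (DX - DY).
Proof.
move=> XD YD i j; rewrite !mxE.
under eq_fun do rewrite !mxE.
exact: is_deriveB (XD i j) (YD i j).
Qed.

Lemma is_derive_bigsum (R : realType) (n : nat) (x : R) (h : 'I_n -> R -> R)
    (dh : 'I_n -> R) :
  (forall i, is_derive x 1 (h i) (dh i)) ->
  is_derive x 1 (fun t => \sum_i h i t) (\sum_i dh i).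
Proof.
move=> hD; rewrite (_ : (fun t => _) = \sum_i h i); first exact: is_derive_sum.
by apply/funext => t; rewrite fct_sumE.
Qed.

Lemma mx_is_derive_mul (R : realType) (m n p : nat) (x : R)
    (X : R -> 'M[R]_(m, n)) (Y : R -> 'M[R]_(n, p)) DX DY :
  mx_is_derive x X DX -> mx_is_derive x Y DY ->
  mx_is_derive x (fun t => X t *m Y t) (DX *m Y x + X x *m DY).
Proof.
move=> XD YD i j; rewrite !mxE -big_split /=.
under eq_fun do rewrite mxE.
apply: is_derive_bigsum => k.
apply: (is_derive_eq (is_deriveM (XD i k) (YD k j))).
by rewrite addrC [in LHS]/GRing.scale /= [Y x k j * _]mulrC.
Qed.

Lemma is_derive_mxtrace (R : realType) (n : nat) (x : R)
    (X : R -> 'M[R]_n) (D : 'M[R]_n) :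
  mx_is_derive x X D -> is_derive x 1 (fun t => \tr (X t)) (\tr D).
Proof. by move=> XD; apply: is_derive_bigsum. Qed.

(** * The cost and the Stiefel constraint along a curve *)

Lemma frobenius_norm_sqr (R : realType) (m n : nat) (X : 'M[R]_(m, n)) :
  frobenius_norm X ^+ 2 = \tr (X^T *m X).
Proof.
rewrite sqr_sqrtr; last by do 2! apply: sumr_ge0 => ? _; exact: sqr_ge0.
rewrite exchange_big; apply: eq_bigr => j _; rewrite mxE.
by apply: eq_bigr => i _; rewrite mxE.
Qed.

Lemma is_derive_procrustes_cost (R : realType) (m n p : nat)
    (A : 'M[R]_(m, n)) (B : 'M[R]_(m, p)) (x : R) (c : R -> 'M[R]_(n, p)) D :
  mx_is_derive x c D ->
  is_derive x 1 (fun t => procrustes_cost A B (c t))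
    (\tr ((A^T *m A *m c x - A^T *m B)^T *m D)).
Proof.
move=> cD; rewrite /procrustes_cost.
under eq_fun do rewrite frobenius_norm_sqr.
have ED := mx_is_deriveB (mx_is_derive_mul (mx_is_derive_cst x A) cD)
  (mx_is_derive_cst x B).
rewrite mul0mx add0r subr0 in ED.
have TD := is_derive_mxtrace (mx_is_derive_mul (mx_is_derive_tr ED) ED).
apply: (is_derive_eq (is_deriveZ 2^-1 TD)).
have -> : A^T *m A *m c x - A^T *m B = A^T *m (A *m c x - B).
  by rewrite mulmxBr mulmxA.
(* The two terms of the product rule are traces of mutually transposed matrices, hence equal; their
   sum cancels the factor [2^-1]. *)
rewrite raddfD /= -[\tr ((A *m D)^T *m _)]mxtrace_tr !trmx_mul !trmxK.
rewrite mulmxA -mulr2n -scalerMnr scalerMnl -mulr_natr mulVf ?pnatr_eq0 //.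
exact: scale1r.
Qed.

Lemma stiefel_velocity_skew (R : realType) (n p : nat) (e : R)
    (c : R -> 'M[R]_(n, p)) (D : 'M[R]_(n, p)) :
  0 < e -> (forall t, `|t| < e -> stiefel (c t)) -> mx_is_derive 0 c D ->
  D^T *m c 0 + (c 0)^T *m D = 0.
Proof.
move=> e0 cS cD; apply/matrixP => i j; rewrite [RHS]mxE.
have [_ <-] := mx_is_derive_mul (mx_is_derive_tr cD) cD i j.
(* The constraint holds only for [|t| < e], so [(c t)^T *m c t] is constant merely near [0], which
   is enough for its derivative there. *)
rewrite (near_eq_derive _ (g := cst ((1%:M : 'M[R]_p) i j))) ?derive_cst//.
near=> t; rewrite cS //; near: t.
Unshelve. all: by end_near. Qed.

(** * Rotation curves in the Stiefel manifold *)

(** Writing [cos t] as [1 - (1 - cos t)] keeps the derivative in the same family, with [(a, b, d)]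
    replaced by [(b, d, - b)]; smoothness then follows by induction on the order. *)
Lemma is_derive_trig (R : realType) (a b d t : R) :
  is_derive t 1 (fun s => a + sin s * b + (1 - cos s) * d)
    (b + sin t * d + (1 - cos t) * - b).
Proof.
have := is_deriveD (is_deriveD (is_derive_cst a t 1)
  (is_deriveM (is_derive_sin t) (is_derive_cst b t 1)))
  (is_deriveM (is_deriveB (is_derive_cst (1 : R) t 1) (is_derive_cos t))
    (is_derive_cst d t 1)).
move=> h; apply: (is_derive_eq h); rewrite /GRing.scale /=; ring.
Qed.

Lemma derivable_derive1n_trig (R : realType) (k : nat) (a b d t : R) :
  derivable (derive1n k (fun s => a + sin s * b + (1 - cos s) * d)) t 1.
Proof.
elim: k a b d => [|k IHk] a b d; first by have [] := is_derive_trig a b d t.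
rewrite /derive1n iterSr -/(derive1n k _).
rewrite (_ : derive1 _ = fun s => b + sin s * d + (1 - cos s) * - b) //.
by apply/funext => s; have [_ <-] := is_derive_trig a b d s; rewrite derive1E.
Qed.

Lemma mxtrace_mul_delta (R : pzSemiRingType) (m n : nat) (M : 'M[R]_(m, n)) a b :
  \tr (M *m delta_mx a b) = M b a.
Proof.
rewrite /mxtrace (bigD1 b) //= big1 => [|i ib]; rewrite !mxE.
  rewrite (bigD1 a) //= big1 => [|j ja]; rewrite !mxE ?eqxx ?(negPf ja) ?mulr0//.
  by rewrite mulr1 !addr0.
by rewrite big1 // => j _; rewrite mxE (negPf ib) andbF mulr0.
Qed.

Definition rotation_mx (R : realType) (n : nat) (J : 'M[R]_n) (t : R) : 'M[R]_n :=
  1%:M + sin t *: J + (1 - cos t) *: (J *m J).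

(* The hypotheses on [J] make [rotation_mx J t] the exponential of [t *: J]
   (Rodrigues' formula). *)
Lemma rotation_mx_stiefel (R : realType) (n : nat) (J : 'M[R]_n) (t : R) :
  J^T = - J -> J *m J *m J = - J -> stiefel (rotation_mx J t).
Proof.
move=> JT J3; rewrite /stiefel /rotation_mx /=.
have J4 : J *m J *m (J *m J) = - (J *m J) by rewrite mulmxA J3 mulNmx.
have J3' : J *m (J *m J) = - J by rewrite mulmxA.
rewrite !linearD /= !linearZ /= trmx1 trmx_mul JT mulNmx mulmxN opprK scalerN.
rewrite !(mulmxDl, mulmxDr, mul1mx, mulmx1, mulNmx, mulmxN).
rewrite -!scalemxAl J4 J3' J3.
move: (J *m J) => K; apply/matrixP => i j; rewrite !mxE.
have := cos2Dsin2 t; set s := sin t; set c := cos t => cs.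
have {}cs : s * s = 1 - c ^+ 2 by rewrite -cs; ring.
(* The odd powers of [J] have cancelled, and [K = J *m J] has coefficient [2(1 - c) - s^2 - (1 -
   c)^2 = 1 - c^2 - s^2]. *)
transitivity ((i == j)%:R + (1 - c ^+ 2 - s * s) * K i j); first ring.
by rewrite cs subrr mul0r addr0.
Qed.

Lemma rotation_mx_mulE (R : realType) (n p : nat) (J : 'M[R]_n)
    (U : 'M[R]_(n, p)) (t : R) i j :
  (rotation_mx J t *m U) i j =
  U i j + sin t * (J *m U) i j + (1 - cos t) * (J *m J *m U) i j.
Proof. by rewrite /rotation_mx !mulmxDl mul1mx -!scalemxAl !mxE. Qed.

Lemma rotation_curve (R : realType) (n p : nat) (J : 'M[R]_n) (U : 'M[R]_(n, p))
    (e : R) :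
  J^T = - J -> J *m J *m J = - J -> stiefel U ->
  smooth_curve_through (@stiefel R n p) U e (fun t => rotation_mx J t *m U).
Proof.
move=> JT J3 UU; split.
- move=> t _; rewrite /stiefel /= trmx_mul mulmxA -(mulmxA U^T).
  by rewrite (rotation_mx_stiefel t JT J3) mulmx1 UU.
- move=> i j k t _; under eq_fun do rewrite rotation_mx_mulE.
  exact: derivable_derive1n_trig.
- by rewrite /rotation_mx sin0 cos0 subrr !scale0r !addr0 mul1mx.
Qed.

Lemma rotation_curve_velocity (R : realType) (n p : nat) (J : 'M[R]_n)
    (U : 'M[R]_(n, p)) :
  mx_is_derive 0 (fun t => rotation_mx J t *m U) (J *m U).
Proof.
move=> i j; under eq_fun do rewrite rotation_mx_mulE.
apply: (is_derive_eq (is_derive_trig _ _ _ _)).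
by rewrite sin0 cos0 subrr !mul0r !addr0.
Qed.

Theorem theorem3p4 (R : realType) (m n p : nat)
    (hp : (1 <= p)%N) (hpn : (p <= n)%N) (hm : (1 <= m)%N)
    (A : 'M[R]_(m, n)) (B : 'M[R]_(m, p)) (U : 'M[R]_(n, p))
    (hU : @stiefel R n p U) :
  critical_point_on (@stiefel R n p) (procrustes_cost A B) U <->
  (B^T *m A *m U)^T = B^T *m A *m U /\
  (1%:M - U *m U^T) *m (A^T *m A *m U - A^T *m B) = 0.
Proof.
set G := A^T *m A *m U - A^T *m B.
have UU : U^T *m U = 1%:M := hU.
(* [U^T *m G] differs from [- (B^T *m A *m U)^T] by a Gram matrix, which is symmetric. *)
have sym_BAU : (B^T *m A *m U)^T = B^T *m A *m U <-> (U^T *m G)^T = U^T *m G.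
  have -> : U^T *m G = (A *m U)^T *m (A *m U) - (B^T *m A *m U)^T.
    by rewrite /G mulmxBr !trmx_mul trmxK !mulmxA.
  have GramT : ((A *m U)^T *m (A *m U))^T = (A *m U)^T *m (A *m U).
    by rewrite trmx_mul trmxK.
  rewrite linearB /= GramT trmxK; split=> [-> //|h].
  by apply/esym; apply: oppr_inj; apply: (addrI _ h).
have cost_deriv c D : c 0 = U -> mx_is_derive 0 c D ->
    is_derive (0 : R) 1 (fun t => procrustes_cost A B (c t)) (\tr (G^T *m D)).
  by move=> c0 /(is_derive_procrustes_cost A B); rewrite c0.
rewrite sym_BAU; split=> [[_ crit]|[symG normalG]].
- have UGsym : (U *m G^T)^T = U *m G^T.
    apply/matrixP => a b; rewrite mxE.
    have [->//|ab] := eqVneq a b.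
    pose J : 'M[R]_n := delta_mx a b - delta_mx b a.
    have JT : J^T = - J by rewrite linearB /= !trmx_delta opprB.
    have ba : b != a by rewrite eq_sym.
    (* For [a != b], [J *m J] is minus the projection onto the coordinates [a] and [b]. *)
    have J3 : J *m J *m J = - J.
      rewrite /J !(mulmxBl, mulmxBr) !(mul_delta_mx, mul_delta_mx_0 _ _ _ ab,
        mul_delta_mx_0 _ _ _ ba, mul0mx, mulNmx, subr0, sub0r, opprB).
      by rewrite addr0 addrC.
    have curve := rotation_curve 1 JT J3 hU.
    have [_ dG0] := crit _ _ ltr01 curve.
    have [_ _ c0] := curve.
    have [_] := cost_deriv _ _ c0 (rotation_curve_velocity J U).
    (* By cyclicity the trace is that of [U *m G^T *m J], which is the difference of the [(b, a)]
       and [(a, b)] entries of [U *m G^T]. *)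
    rewrite dG0 mulmxA mxtrace_mulC mulmxA mulmxBr raddfB /=.
    rewrite !mxtrace_mul_delta => /esym/eqP.
    by rewrite subr_eq0 => /eqP ->.
  have GE : G = U *m G^T *m U by rewrite -UGsym trmx_mul trmxK -mulmxA UU mulmx1.
  have GU : U^T *m G = G^T *m U by rewrite [in LHS]GE !mulmxA UU mul1mx.
  split; first by rewrite {1}GU trmx_mul trmxK.
  by rewrite mulmxBl mul1mx -mulmxA GU mulmxA -GE subrr.
- split=> // e c e0 [cS cderiv c0].
  pose D := \matrix_(i, j) 'D_1 (fun t => c t i j) (0 : R).
  have cD : mx_is_derive 0 c D.
    move=> i j; rewrite mxE; apply: derivableP.
    (* The iterated derivative of order [0] is the entry itself. *)
    by apply: (cderiv i j 0%N); rewrite normr0.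
  apply: (is_derive_eq (cost_deriv c D c0 cD)).
  have skew := stiefel_velocity_skew e0 cS cD; rewrite c0 in skew.
  have {normalG} GE : G = U *m (U^T *m G).
    by apply/eqP; rewrite -subr_eq0 mulmxA -[X in X - _]mul1mx -mulmxBl normalG.
  have trE : \tr (G^T *m D) = \tr (U^T *m G *m (U^T *m D)).
    by rewrite {1}GE trmx_mul symG !mulmxA.
  (* A symmetric matrix is trace-orthogonal to a skew one: with [S = U^T *m G] and [W = U^T *m D],
     transposing gives [\tr (S *m W) = \tr (S *m W^T)], and [W^T + W = 0]. *)
  have : \tr (G^T *m D) *+ 2 = 0.
    rewrite mulr2n {1}trE trE -{1}mxtrace_tr trmx_mul symG trmx_mul trmxK.
    by rewrite mxtrace_mulC -raddfD /= -mulmxDr skew mulmx0 raddf0.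
  by move/eqP; rewrite mulrn_eq0 => /eqP.
Qed.
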